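(* Let $([n],[m],\mathcal{V})$ be a mixed fair division instance with additive valuations, let $S\subset[m]$, and let $A=(A_1,\dots,A_n)$ be a partial EQ1 allocation that allocates exactly the items of $S$. If $O^{\pm}\subseteq S$, then $A$ can be completed while preserving EQ1; that is, there is a complete EQ1 allocation $B=(B_1,\dots,B_n)$ of $[m]$ with $A_i\subseteq B_i$ for all $i\in[n]$.
   Context: A (mixed) fair division instance $([n],[m],\mathcal{V})$ consists of $n$ agents, a set $O=[m]$ of $m$ indivisible items, and valuations $\mathcal{V}=\{v_1,\dots,v_n\}$ with $v_i:2^{[m]}\to\mathbb{Z}$ additive: $v_i(S)=\sum_{o\in S}v_i(o)$. Values may be positive, negative or zero. A partial allocation of $S\subseteq[m]$ is a tuple $A=(A_1,\dots,A_n)$ of pairwise disjoint (possibly empty) bundles with union $S$; it is complete if $S=[m]$. An item $o$ is an objective good if $v_i(o)\ge 0$ for all agents $i$, and an objective chore if $v_i(o)\le 0$ for all agents $i$. All other items are called subjective, and $O^{\pm}$ denotes the set of subjective items. A (partial or complete) allocation $A$ is EQ1 (equitable up to one item) if for every pair of agents $i,j$ with $v_i(A_i)<v_j(A_j)$, either there exists $g\in A_j$ with $v_j(g)\ge 0$ such that $v_i(A_i)\ge v_j(A_j\setminus\{g\})$, or there exists $c\in A_i$ with $v_i(c)\le 0$ such that $v_i(A_i\setminus\{c\})\ge v_j(A_j)$. *)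

(* Defs.v *)
From mathcomp Require Import all_boot all_order all_algebra.

Set Implicit Arguments.
Unset Strict Implicit.
Unset Printing Implicit Defensive.

Import Order.TTheory GRing.Theory Num.Theory.

Local Open Scope ring_scope.

(* The value of a single item o for agent i is v i [set o]. *)
Definition valuations (n m : nat) : Type := 'I_n -> {set 'I_m} -> int.

Definition additive_valuations (n m : nat) (v : valuations n m) : Prop :=
  forall (i : 'I_n) (S : {set 'I_m}), v i S = \sum_(o in S) v i [set o].

Definition partial_allocation (n m : nat) (S : {set 'I_m})
    (A : 'I_n -> {set 'I_m}) : Prop :=
  (forall i j : 'I_n, i != j -> [disjoint A i & A j]) /\
  \bigcup_(i < n) A i = S.

Definition complete_allocation (n m : nat) (A : 'I_n -> {set 'I_m}) : Prop :=
  partial_allocation [set: 'I_m] A.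

Definition objective_good (n m : nat) (v : valuations n m) (o : 'I_m) : bool :=
  [forall i : 'I_n, 0 <= v i [set o]].

Definition objective_chore (n m : nat) (v : valuations n m) (o : 'I_m) : bool :=
  [forall i : 'I_n, v i [set o] <= 0].

Definition subjective_items (n m : nat) (v : valuations n m) : {set 'I_m} :=
  [set o | ~~ objective_good v o && ~~ objective_chore v o].

Definition EQ1 (n m : nat) (v : valuations n m)
    (A : 'I_n -> {set 'I_m}) : Prop :=
  forall i j : 'I_n, v i (A i) < v j (A j) ->
    (exists g : 'I_m, [/\ g \in A j, 0 <= v j [set g] &
       v j (A j :\ g) <= v i (A i)]) \/
    (exists c : 'I_m, [/\ c \in A i, v i [set c] <= 0 &
       v j (A j) <= v i (A i :\ c)]).

(* Main.v *)
(* Complete the allocation one item at a time: an objective good goes to an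
   agent whose bundle currently has minimum value, an objective chore to an
   agent whose bundle has maximum value.  Removing the new item then settles
   every comparison it could spoil, and the witnesses of all other comparisons
   remain valid. *)
Require Import Defs.
From mathcomp Require Import all_boot all_order all_algebra.
From mathcomp Require Import lra.

Set Implicit Arguments.
Unset Strict Implicit.
Unset Printing Implicit Defensive.

Import Order.TTheory GRing.Theory Num.Theory.
Local Open Scope ring_scope.

Definition give (n m : nat) (A : 'I_n -> {set 'I_m}) (p : 'I_n) (o : 'I_m) :
  'I_n -> {set 'I_m} := fun i => if i == p then o |: A i else A i.

Lemma sub_give (n m : nat) (A : 'I_n -> {set 'I_m}) p o i :
  A i \subset give A p o i.
Proof. by rewrite /give; case: eqP => // _; exact: subsetUr. Qed.

Lemma partial_allocation_give (n m : nat) (S : {set 'I_m})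
    (A : 'I_n -> {set 'I_m}) p o :
  partial_allocation S A -> o \notin S ->
  partial_allocation (o |: S) (give A p o).
Proof.
move=> [disA covA] oS.
have oA i : o \notin A i.
  by apply: contra oS => oAi; rewrite -covA; apply/bigcupP; exists i.
have disjointU i j : i != j -> [disjoint o |: A i & A j].
  move=> neq_ij; rewrite disjoints_subset subUset sub1set inE oA.
  by rewrite -disjoints_subset disA.
split=> [i j neq_ij|].
  rewrite /give; case: (eqVneq i p) => [ip|_]; case: (eqVneq j p) => [jp|_].
  - by rewrite ip jp eqxx in neq_ij.
  - by rewrite disjointU.
  - by rewrite disjoint_sym disjointU // eq_sym.
  - exact: disA.
apply/setP => x; rewrite in_setU1 -covA; apply/bigcupP/orP.
  move=> [i _]; rewrite /give; case: eqP => _; last first.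
    by move=> xA; right; apply/bigcupP; exists i.
  by case/setU1P => [->|xA]; [left | right; apply/bigcupP; exists i].
case=> [/eqP->|/bigcupP[i _ xA]].
  by exists p => //; rewrite /give eqxx setU11.
by exists i => //; exact: (subsetP (sub_give A p o i)).
Qed.

Section Extension.
Variables (n m : nat) (v : valuations n m).
Hypothesis vadd : additive_valuations v.
Implicit Types (X : {set 'I_m}) (A : 'I_n -> {set 'I_m}).

Lemma valueU1 i o X : o \notin X -> v i (o |: X) = v i [set o] + v i X.
Proof.
by move=> oX; rewrite vadd big_setU1 //= -(vadd i X).
Qed.

Lemma valueD1 i o X : o \in X -> v i (X :\ o) = v i X - v i [set o].
Proof.
move=> oX; rewrite -{2}(setD1K oX) valueU1 ?setD11 //.
by rewrite addrC addKr.
Qed.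

(** Only comparisons involving [p] change. Those with [p] as the poorer agent keep their old
    witness; those with [p] as the richer agent are settled by [o]. *)
Lemma EQ1_give_good A p o :
    EQ1 v A -> o \notin A p -> 0 <= v p [set o] ->
    (forall i, v p (A p) <= v i (A i)) ->
  EQ1 v (give A p o).
Proof.
move=> eqA oA o_ge0 pmin i j; rewrite /give.
case: (eqVneq i p) => [->|_]; case: (eqVneq j p) => [->|_]; last exact: eqA.
- by rewrite ltxx.
(* As [o] does not lower the value of [p], agent [p] was already behind [j] under [A]. Either old
   witness still works, since the side of [p] only gains the value of [o]. *)
- rewrite (valueU1 _ oA) => lt_pj.
  case: (eqA p j) => [|[g [gA g_ge0 le_g]]|[c [cA c_le0 le_c]]]; first by lra.
    by left; exists g; split=> //; lra.
  right; exists c; split=> //; first by rewrite setU1r.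
  by move: le_c; rewrite !valueD1 ?setU1r // (valueU1 _ oA); lra.
(* Removing [o] gives back [A p], whose value is minimal by [pmin]. *)
- move=> _; left; exists o; split=> //; first exact: setU11.
  by rewrite setU1K.
Qed.

(** Mirror image of the case of a good: with [p] poorer, removing [o] restores the maximal value;
    with [p] richer, [p] was even further ahead before, and the loss from [o] only helps the old
    witness. *)
Lemma EQ1_give_chore A p o :
    EQ1 v A -> o \notin A p -> v p [set o] <= 0 ->
    (forall i, v i (A i) <= v p (A p)) ->
  EQ1 v (give A p o).
Proof.
move=> eqA oA o_le0 pmax i j; rewrite /give.
case: (eqVneq i p) => [->|_]; case: (eqVneq j p) => [->|_]; last exact: eqA.
- by rewrite ltxx.
- move=> _; right; exists o; split=> //; first exact: setU11.
  by rewrite setU1K.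
- rewrite (valueU1 _ oA) => lt_ip.
  case: (eqA i p) => [|[g [gA g_ge0 le_g]]|[c [cA c_le0 le_c]]]; first by lra.
    left; exists g; split=> //; first by rewrite setU1r.
    by move: le_g; rewrite !valueD1 ?setU1r // (valueU1 _ oA); lra.
  by right; exists c; split=> //; lra.
Qed.

(** The current values dictate who receives [o], so its sign must suit whichever agent that turns
    out to be; this is where objectivity enters. *)
Lemma EQ1_give A o :
    (0 < n)%N -> EQ1 v A -> (forall i, o \notin A i) ->
    objective_good v o || objective_chore v o ->
  exists p, EQ1 v (give A p o).
Proof.
move=> n_gt0 eqA oA; pose i0 := Ordinal n_gt0.
case/orP => /forallP ov.
  case: (@Order.TotalTheory.arg_minP _ _ _ i0 predT (fun i => v i (A i)))
    => // p _ pmin.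
  by exists p; apply: EQ1_give_good => // i; exact: pmin.
case: (@Order.TotalTheory.arg_maxP _ _ _ i0 predT (fun i => v i (A i)))
  => // p _ pmax.
by exists p; apply: EQ1_give_chore => // i; exact: pmax.
Qed.

End Extension.

Theorem lemma3p4 (n m : nat) (v : valuations n m) (S : {set 'I_m})
    (A : 'I_n -> {set 'I_m}) :
  (0 < n)%N ->
  additive_valuations v ->
  partial_allocation S A ->
  EQ1 v A ->
  subjective_items v \subset S ->
  exists B : 'I_n -> {set 'I_m},
    [/\ complete_allocation B, EQ1 v B & forall i : 'I_n, A i \subset B i].
Proof.
move=> n_gt0 vadd.
(* Induction on a bound for the number of unallocated items, with [S] and [A] general because both
   grow. *)
have [k] := ubnP #|~: S|; elim: k S A => // k IHk S A ltSk allocA eqA subjS.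
have [S_full|[o]] := set_0Vmem (~: S).
  exists A; split=> //.
  by rewrite /complete_allocation -setC0 -S_full setCK.
rewrite inE => oS.
have oA i : o \notin A i.
  by apply: contra oS => oAi; case: allocA => _ <-; apply/bigcupP; exists i.
(* All subjective items lie in [S], and [o] does not. *)
have o_obj : objective_good v o || objective_chore v o.
  have := contra (subsetP subjS o) oS.
  by rewrite inE -negb_or negbK.
have [p eqAp] := EQ1_give vadd n_gt0 eqA oA o_obj.
have [||||B [allB eqB subB]] := IHk (o |: S) (give A p o).
- rewrite -ltnS (leq_trans _ ltSk) // ltnS proper_card // properC.
  by rewrite properE subsetUr subUset sub1set (negbTE oS).
- exact: partial_allocation_give.
- exact: eqAp.
- exact: subset_trans subjS (subsetUr _ _).
by exists B; split=> // i; exact: subset_trans (sub_give A p o i) (subB i).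
Qed.
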